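(* Let $G$ be a finite set with $|G|=n$. The free algebra $\mathcal{F}_{\mathcal{BPK}_0}(G)$ over $G$ in the variety $\mathcal{BPK}_0$ satisfies $$\mathcal{F}_{\mathcal{BPK}_0}(G)\cong \mathbf{2}^{2^n}\times\mathbf{3}^{3^n-2^n}\times\prod_{k=2}^{2^n}\mathbb{B}_k^{\,\frac{1}{k!}\sum_{i=0}^n 2^{n-i}f(n,k,i)},$$ where $f(n,k,i)=\binom{n}{i}\,g(n-i,k)$, and $g(m,k)$ denotes the number of surjective Boolean homomorphisms $h$ from the free Boolean algebra on a set of $m$ free generators onto the Boolean algebra with $k$ atoms such that $h(g)\neq1$ for every free generator $g$.
   Context: Algebras are in the signature $\langle L,\wedge,\vee,{}',{}^*,0,1\rangle$. For $k\ge1$, $\mathbb{B}_k$ is the algebra whose lattice is obtained by placing one copy $B_k^+$ of the Boolean lattice $B_k$ with $k$ atoms above another copy $B_k^-$, identifying the top of $B_k^-$ with the bottom of $B_k^+$; ${}'$ is the order-reversing involution sending an element $a$ of the lower copy to the element of the upper copy corresponding to the Boolean complement of $a$ (and vice versa), and ${}^*$ is the pseudocomplement ($a\wedge b=0\Leftrightarrow b\le a^*$). $\mathbf{2}$ is the two-element algebra (chain) and $\mathbf{3}=\mathbb{B}_1$ is the three-element chain. $\mathcal{BPK}_0$ is the variety generated by $\{\mathbb{B}_k:k\ge1\}$. *)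

(* Defs.v *)
From mathcomp Require Import all_boot.

Set Implicit Arguments.
Unset Strict Implicit.
Unset Printing Implicit Defensive.

Record alg : Type := Alg {
  carrier :> Type;
  ameet : carrier -> carrier -> carrier;
  ajoin : carrier -> carrier -> carrier;
  aneg : carrier -> carrier;
  astar : carrier -> carrier;
  azero : carrier;
  aone : carrier }.

Arguments azero : clear implicits.
Arguments aone : clear implicits.

Record is_hom (A B : alg) (h : A -> B) : Prop := IsHom {
  hom_meet : forall x y, h (ameet x y) = ameet (h x) (h y);
  hom_join : forall x y, h (ajoin x y) = ajoin (h x) (h y);
  hom_neg : forall x, h (aneg x) = aneg (h x);
  hom_star : forall x, h (astar x) = astar (h x);
  hom_zero : h (azero A) = azero B;
  hom_one : h (aone A) = aone B }.

Definition alg_iso (A B : alg) : Prop :=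
  exists h : A -> B, is_hom h /\ bijective h.

Definition alg_prod (I : Type) (A : I -> alg) : alg :=
  @Alg (forall i, A i)
    (fun x y i => ameet (x i) (y i)) (fun x y i => ajoin (x i) (y i))
    (fun x i => aneg (x i)) (fun x i => astar (x i))
    (fun i => azero (A i)) (fun i => aone (A i)).

Definition alg_pow (A : alg) (m : nat) : alg := alg_prod (fun _ : 'I_m => A).

Definition alg_prod2 (A B : alg) : alg :=
  @Alg (A * B)
    (fun x y => (ameet x.1 y.1, ameet x.2 y.2))
    (fun x y => (ajoin x.1 y.1, ajoin x.2 y.2))
    (fun x => (aneg x.1, aneg x.2)) (fun x => (astar x.1, astar x.2))
    (azero A, azero B) (aone A, aone B).

(* Closure under H, S and P; closure under S is stated for embeddings, which
   amounts to the same thing in the presence of closure under H. *)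
Record is_variety (V : alg -> Prop) : Prop := IsVariety {
  variety_H : forall (A B : alg) (h : A -> B),
    V A -> is_hom h -> (forall y, exists x, h x = y) -> V B;
  variety_S : forall (A B : alg) (h : B -> A),
    V A -> is_hom h -> injective h -> V B;
  variety_P : forall (I : Type) (A : I -> alg),
    (forall i, V (A i)) -> V (alg_prod A) }.

Definition variety_gen (K : alg -> Prop) (A : alg) : Prop :=
  forall V : alg -> Prop, is_variety V -> (forall B, K B -> V B) -> V A.

Definition is_free (V : alg -> Prop) (G : Type) (F : alg) (iota : G -> F) :
    Prop :=
  V F /\
  forall (A : alg) (v : G -> A), V A ->
    exists h : F -> A,
      [/\ is_hom h, (forall x, h (iota x) = v x)
        & forall h' : F -> A,
            is_hom h' -> (forall x, h' (iota x) = v x) -> h' =1 h].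

Definition alg2 : alg := @Alg bool andb orb negb negb false true.

Section Bk.
Variable k : nat.

(* The Boolean lattice with k atoms is {set 'I_k}. The element a of the lower
   copy is encoded as (a, set0) and the element b of the upper copy as
   (setT, b), so that the top of the lower copy and the bottom of the upper one
   are both (setT, set0), and the order of the glued lattice is the
   componentwise inclusion. *)
Definition in_Bk (p : {set 'I_k} * {set 'I_k}) : bool :=
  (p.1 == setT) || (p.2 == set0).

Definition Bk_sort : Type := {p : {set 'I_k} * {set 'I_k} | in_Bk p}.

Implicit Types x y : Bk_sort.

Fact Bk_meet_subproof x y :
  in_Bk ((val x).1 :&: (val y).1, (val x).2 :&: (val y).2).
Proof.
case: x y => [[a b] /= ab] [[c d] /= cd]; move: ab cd; rewrite /in_Bk /=.
case/orP=> /eqP-> ; last by rewrite set0I eqxx orbT.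
by case/orP=> /eqP->; rewrite ?setI0 ?setTI eqxx ?orbT.
Qed.

Fact Bk_join_subproof x y :
  in_Bk ((val x).1 :|: (val y).1, (val x).2 :|: (val y).2).
Proof.
case: x y => [[a b] /= ab] [[c d] /= cd]; move: ab cd; rewrite /in_Bk /=.
case/orP=> /eqP-> ; first by rewrite setTU eqxx.
by case/orP=> /eqP->; rewrite ?setUT ?set0U eqxx ?orbT.
Qed.

Fact Bk_neg_subproof x : in_Bk (~: (val x).2, ~: (val x).1).
Proof.
case: x => [[a b] /=]; rewrite /in_Bk /=.
by case/orP=> /eqP->; rewrite ?setCT ?setC0 eqxx ?orbT.
Qed.

Fact Bk_zero_subproof : in_Bk (set0, set0).
Proof. by rewrite /in_Bk /= eqxx orbT. Qed.

Fact Bk_one_subproof : in_Bk (setT, setT).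
Proof. by rewrite /in_Bk /= eqxx. Qed.

Fact Bk_low_subproof (a : {set 'I_k}) : in_Bk (a, set0).
Proof. by rewrite /in_Bk /= eqxx orbT. Qed.

Definition Bk_meet x y : Bk_sort := exist (fun p => is_true (in_Bk p)) _ (Bk_meet_subproof x y).
Definition Bk_join x y : Bk_sort := exist (fun p => is_true (in_Bk p)) _ (Bk_join_subproof x y).
Definition Bk_neg x : Bk_sort := exist (fun p => is_true (in_Bk p)) _ (Bk_neg_subproof x).
Definition Bk_zero : Bk_sort := exist (fun p => is_true (in_Bk p)) _ Bk_zero_subproof.
Definition Bk_one : Bk_sort := exist (fun p => is_true (in_Bk p)) _ Bk_one_subproof.

Definition Bk_star x : Bk_sort :=
  if x == Bk_zero then Bk_one else exist (fun p => is_true (in_Bk p)) _ (Bk_low_subproof (~: (val x).1)).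

Definition Bk : alg :=
  @Alg Bk_sort Bk_meet Bk_join Bk_neg Bk_star Bk_zero Bk_one.

Lemma Bk_starP x y : Bk_meet x y = Bk_zero <-> Bk_meet y (Bk_star x) = y.
Proof.
rewrite /Bk_star; have [->|x0] := eqVneq x Bk_zero.
  split=> _; apply: val_inj; case: y => [[c d] /= _]; first by rewrite !setIT.
  by rewrite !set0I.
case: x y x0 => [[a b] /= ab] [[c d] /= cd] x0.
have a0 : a != set0.
  apply: contra x0 => /eqP a0; apply/eqP/val_inj => /=; rewrite a0.
  move: ab; rewrite /in_Bk a0 /= => /orP[|/eqP->//].
  move=> /eqP T0; congr pair; apply/setP=> i.
  by have := in_setT i; rewrite -T0 inE.
split=> [/(congr1 val)[ac bd]|/(congr1 val)[ca d0]]; apply: val_inj => /=.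
  have ca : c :&: ~: a = c.
    by rewrite -setDE; apply/setDidPl; rewrite -setI_eq0 setIC ac.
  rewrite ca; congr pair; move: cd; rewrite /in_Bk /=.
  case/orP=> /eqP ec; last by rewrite ec setI0.
  by move: a0; rewrite -ac ec setIT eqxx.
rewrite -d0 !setI0 -ca; congr pair.
by rewrite setIC -setIA [~: a :&: a]setIC setICr setI0.
Qed.

End Bk.

Definition alg3 : alg := Bk 1.

Definition BPK0 : alg -> Prop :=
  variety_gen (fun A => exists2 k : nat, 0 < k & A = Bk k).

Record is_bool_hom (T U : finType) (h : {set T} -> {set U}) : Prop :=
  IsBoolHom {
    bool_hom_meet : forall X Y, h (X :&: Y) = h X :&: h Y;
    bool_hom_join : forall X Y, h (X :|: Y) = h X :|: h Y;
    bool_hom_compl : forall X, h (~: X) = ~: h X;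
    bool_hom_bot : h set0 = set0;
    bool_hom_top : h setT = setT }.

Definition is_bool_homb (T U : finType) (h : {ffun {set T} -> {set U}}) :=
  [&& [forall X, forall Y, h (X :&: Y) == h X :&: h Y],
      [forall X, forall Y, h (X :|: Y) == h X :|: h Y],
      [forall X, h (~: X) == ~: h X], h set0 == set0 & h setT == setT].

Lemma is_bool_homP (T U : finType) (h : {ffun {set T} -> {set U}}) :
  reflect (is_bool_hom h) (is_bool_homb h).
Proof.
apply: (iffP and5P) => [[hI hU hC h0 hT]|[hI hU hC h0 hT]]; split=> //.
- by move=> X Y; apply/eqP; move/forallP/(_ X)/forallP/(_ Y): hI.
- by move=> X Y; apply/eqP; move/forallP/(_ X)/forallP/(_ Y): hU.
- by move=> X; apply/eqP; move/forallP/(_ X): hC.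
- exact/eqP.
- exact/eqP.
- by apply/forallP=> X; apply/forallP=> Y; apply/eqP.
- by apply/forallP=> X; apply/forallP=> Y; apply/eqP.
- by apply/forallP=> X; apply/eqP.
- exact/eqP.
- exact/eqP.
Qed.

(* The free Boolean algebra on m free generators is the powerset of the set of
   valuations of m propositional variables, a valuation being identified with
   the set of the variables that it makes true. *)
Notation FreeBool m := {set {set 'I_m}}.

Definition bgen (m : nat) (i : 'I_m) : FreeBool m :=
  [set S : {set 'I_m} | i \in S].

(* Every finite Boolean algebra is isomorphic to some {set U}. *)
Lemma FreeBool_free (m : nat) (U : finType) (v : 'I_m -> {set U}) :
  exists h : FreeBool m -> {set U},
    [/\ is_bool_hom h, (forall i, h (bgen i) = v i)
      & forall h' : FreeBool m -> {set U},
          is_bool_hom h' -> (forall i, h' (bgen i) = v i) -> h' =1 h].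
Proof.
pose h0 (X : FreeBool m) := [set u | [set i | u \in v i] \in X].
exists h0; split=> [|i|h' [hI hU hC h'0 hT] hv X].
- by split=> [X Y|X Y|X||]; apply/setP=> u; rewrite !inE.
- by apply/setP=> u; rewrite !inE.
pose at_ u : {set 'I_m} := [set i | u \in v i].
have at1 u : u \in h' [set at_ u].
  have -> : [set at_ u] =
      \bigcap_(i : 'I_m) (if u \in v i then bgen i else ~: bgen i).
    apply/setP=> S; rewrite inE; apply/eqP/bigcapP => [-> i _|hS].
      by case: ifP => ui; rewrite !inE ui.
    apply/setP=> i; rewrite inE; have := hS i isT.
    by case: ifP => ui; rewrite !inE // => /negPf.
  rewrite (big_morph h' hI hT); apply/bigcapP => i _.
  by case: ifP => ui; rewrite ?hC hv ?inE ui.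
have mono (Y Z : FreeBool m) u : Y \subset Z -> u \in h' Y -> u \in h' Z.
  by move=> /setIidPl <-; rewrite hI inE => /andP[].
apply/setP=> u; rewrite [RHS]inE; apply/idP/idP => [uX|uX]; last first.
  by apply: mono (at1 u); rewrite sub1set.
apply: contraLR uX => uX; have := mono _ (~: X) _ _ (at1 u).
by rewrite hC sub1set !inE; apply.
Qed.

Definition gnum (m k : nat) : nat :=
  #|[set h : {ffun FreeBool m -> {set 'I_k}} |
      [&& is_bool_homb h, [forall Y, exists X, h X == Y]
        & [forall i : 'I_m, h (bgen i) != setT]]]|.

Definition fnum (n k i : nat) : nat := 'C(n, i) * gnum (n - i) k.

(* Main.v *)
Require Import Defs.
From mathcomp Require Import all_boot.
From Stdlib Require Import FunctionalExtensionality IndefiniteDescription.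

Set Implicit Arguments.
Unset Strict Implicit.
Unset Printing Implicit Defensive.

(** The theorem is proved by exhibiting the product on the right-hand side as a
free algebra.

The algebra B_k is simple and its subalgebras are 2 and copies of
the B_l with l <= k, so the free algebra should be the product, over all
valuations v : G -> C that generate C in {2, B_1, B_2, ...}, taken up to
isomorphism, of the algebras C.  These valuations have the following
combinatorial description.  An element of B_k other than the middle element e
(the glued point) is either a proper subset a of the set of atoms, seen in the
lower copy, or the negation of such an a.  Forgetting which one gives a shadow
(x /\ x', in the lower copy), and reading the shadows of the v(g) atom by atom
attaches to each atom u the set p(u) of the generators whose shadow contains
u.  Hence v amounts to p together with the set D of the generators sent
strictly above e (gmap, gmapP), where no generator of D belongs to all the
p(u).  It generates B_k, for k >= 2, iff p is injective; up to permutation of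
the atoms only the image X of p matters.  The factors are therefore indexed by
the pairs (X, D) with X a nonempty set of subsets of G and D disjoint from the
intersection of X (cells): the factor is 2 when X is {empty set}, and B_k with
k = |X| otherwise.

That the resulting product is free rests on two facts.

- An identity that holds in the product at the tuple of the canonical
  valuations holds at every valuation in every B_k (target_sep), because such
  a valuation factors through the one of its pair (X, D).  It then holds in the
  whole variety (target_identities).

- Every element of the product is the value of a term (target_gen).  Since x'*
  sends 1 to 1, the upper elements other than 1 to the lower copy, and the
  lower elements other than 1 to 0, applying x'* twice decides whether x = 1;
  so the pair (X, D) of a valuation can be recognised by a term (ev_delta), and
  terms that behave as wanted on each factor separately can be glued together
  (ev_glue).  Within one factor the terms minterm S produce the atoms (ev_gen).

The exponents come from counting cells.  Ordering X by all its k! enumerations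
turns the sets X with empty intersection into injections p of k points into
the powerset of m generators; by duality for finite Boolean algebras these are
the surjective homomorphisms counted by gnum m k (gnum_families).  A set X
with intersection A is a set with empty intersection on the complement of A,
and leaves 2^(n-|A|) choices for D, which gives the formula (sum_fnum). *)

(** * Terms *)

Inductive term (G : Type) : Type :=
  | Var of G
  | Meet of term G & term G
  | Join of term G & term G
  | Neg of term G
  | Star of term G
  | Zero
  | One.

Arguments Zero {G}.
Arguments One {G}.

Fixpoint eval (G : Type) (A : alg) (v : G -> A) (t : term G) : A :=
  match t with
  | Var g => v g
  | Meet s t => ameet (eval v s) (eval v t)
  | Join s t => ajoin (eval v s) (eval v t)
  | Neg s => aneg (eval v s)
  | Star s => astar (eval v s)
  | Zero => azero A
  | One => aone A
  end.

Lemma eval_ext (G : Type) (A : alg) (v w : G -> A) (t : term G) :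
  v =1 w -> eval v t = eval w t.
Proof.
by move=> vw; elim: t => //= [s -> t ->|s -> t ->|s ->|s ->].
Qed.

Lemma eval_hom (G : Type) (A B : alg) (h : A -> B) (v : G -> A) (t : term G) :
  is_hom h -> h (eval v t) = eval (fun g => h (v g)) t.
Proof.
case=> hI hU hN hS h0 h1.
by elim: t => //= [s <- t <-|s <- t <-|s <-|s <-].
Qed.

(** * The algebras B_k and their valuations *)

Section BkCoordinates.
Variable k : nat.

Definition lo (x : Bk k) : {set 'I_k} := (val (x : Bk_sort k)).1.
Definition hi (x : Bk k) : {set 'I_k} := (val (x : Bk_sort k)).2.

Lemma Bk_ext (x y : Bk k) : lo x = lo y -> hi x = hi y -> x = y.
Proof.
rewrite /lo /hi => e1 e2; apply: val_inj.
by rewrite [val x]surjective_pairing e1 e2 -surjective_pairing.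
Qed.

Lemma Bk_lohi (x : Bk k) : lo x = setT \/ hi x = set0.
Proof. by have /orP[/eqP|/eqP] := valP (x : Bk_sort k); [left|right]. Qed.

Definition low (a : {set 'I_k}) : Bk k :=
  exist (fun p => is_true (in_Bk p)) (a, set0) (Bk_low_subproof a).

Definition up (b : {set 'I_k}) : Bk k := aneg (low (~: b)).

Lemma lo_up b : lo (up b) = setT. Proof. by rewrite /lo /= setC0. Qed.
Lemma hi_up b : hi (up b) = b. Proof. by rewrite /hi /= setCK. Qed.

Lemma lo_star (x : Bk k) : lo (astar x) = ~: lo x.
Proof.
rewrite /= /Bk_star; case: eqVneq => [->|//].
by rewrite /lo /= setC0.
Qed.

(** The case distinction in the definition of the pseudocomplement reappears
here as a test on the lower coordinate alone, which is empty only at 0. *)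
Lemma hi_star (x : Bk k) : hi (astar x) = if lo x == set0 then setT else set0.
Proof.
rewrite /= /Bk_star; case: eqVneq => [->|x0]; first by rewrite /lo /hi /= eqxx.
rewrite /hi /=; case: eqVneq => // lx; case/eqP: x0; apply: Bk_ext => //.
case: (Bk_lohi x) => // lT; apply/setP=> i.
by have := in_setT i; rewrite -lT lx inE.
Qed.

End BkCoordinates.

Lemma ord_setT0 k : 0 < k -> (set0 : {set 'I_k}) != setT.
Proof.
by move=> k0; apply/eqP=> /setP/(_ (Ordinal k0)); rewrite !inE.
Qed.

(** The embedding of 2 into B_k lets the value of a term that can only be 0 or 1
be recorded as a boolean. *)
Definition emb (k : nat) (b : bool) : Bk k :=
  if b then aone (Bk k) else azero (Bk k).

Lemma emb_hom (k : nat) : 0 < k -> is_hom (emb k : alg2 -> Bk k).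
Proof.
move=> k0; have T0 := negPf (ord_setT0 k0).
split=> //.
  1,2: by case; case; apply: Bk_ext => //=; apply/setP=> u; rewrite !inE.
  by case; apply: Bk_ext => //=; apply/setP=> u; rewrite !inE.
case; apply: Bk_ext; rewrite ?lo_star ?hi_star /lo /hi /=;
  rewrite ?eqxx ?setCT ?setC0 //.
by rewrite eq_sym T0.
Qed.

Lemma emb_inj (k : nat) : 0 < k -> injective (emb k).
Proof.
move=> k0; have /eqP T0 := ord_setT0 k0.
by case; case=> // /(congr1 (@lo k)) => // E; case: T0; rewrite /lo /= in E *.
Qed.

Section Pullback.
Variables (k l : nat) (psi : 'I_k -> 'I_l).

Fact pull_subproof (x : Bk l) : in_Bk (psi @^-1: lo x, psi @^-1: hi x).
Proof.
rewrite /in_Bk /=; case: (Bk_lohi x) => ->.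
  by rewrite preimsetT eqxx.
by rewrite preimset0 eqxx orbT.
Qed.

Definition pull (x : Bk l) : Bk k :=
  exist (fun p => is_true (in_Bk p)) _ (pull_subproof x).

(** A map of atoms always pulls back the lattice operations and the negation;
surjectivity is what keeps a nonzero element nonzero, as the pseudocomplement
requires. *)
Lemma pull_hom : (forall j, exists i, psi i = j) -> is_hom pull.
Proof.
move=> psi_surj.
split; try by move=> *; apply: Bk_ext; apply/setP=> u; rewrite !inE.
move=> x; apply: Bk_ext; apply/setP=> u.
  by rewrite lo_star !inE lo_star inE.
rewrite hi_star !inE hi_star.
have -> : (lo (pull x) == set0) = (lo x == set0).
  rewrite -[lo (pull x)]/(psi @^-1: lo x).
  apply/eqP/eqP => [/setP x0|->]; last exact: preimset0.
  by apply/setP=> i; have [j <-] := psi_surj i; have := x0 j; rewrite !inE.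
by case: ifP; rewrite !inE.
Qed.

End Pullback.

Section Valuations.
Variable G : finType.
Implicit Types (g : G) (S D : {set G}) (X : {set {set G}}).

(** The valuation described by the sets [p u] of generators attached to the
atoms [u] and by the set [D] of the generators placed in the upper copy: in
both copies the shadow of [g] is the set of the atoms [u] with [g \in p u]. *)
Definition gmap (k : nat) (p : 'I_k -> {set G}) D g : Bk k :=
  if g \in D then up [set u | g \notin p u] else low [set u | g \in p u].

Lemma pull_gmap (k l : nat) (psi : 'I_k -> 'I_l) (p : 'I_l -> {set G}) D g :
  pull psi (gmap p D g) = gmap (fun u => p (psi u)) D g.
Proof.
rewrite /gmap; case: ifP => _; apply: Bk_ext;
  by apply/setP=> u; rewrite !inE.
Qed.

Lemma eval_gmap_comp (k l : nat) (psi : 'I_k -> 'I_l) (p : 'I_l -> {set G})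
    D t :
  (forall j, exists i, psi i = j) ->
  eval (gmap (fun u => p (psi u)) D) t = pull psi (eval (gmap p D) t).
Proof.
move=> /pull_hom hp; rewrite (eval_hom _ _ hp).
by apply: eval_ext => g; rewrite pull_gmap.
Qed.

(** When all shadows are empty, only the values 0 and 1 occur. *)
Lemma eval_gmap_set0 (k : nat) (p : 'I_k -> {set G}) D t : 0 < k ->
  (forall u, p u = set0) ->
  eval (gmap p D) t = emb k (eval (A := alg2) (fun g => g \in D) t).
Proof.
move=> k0 p0; rewrite (eval_hom (A := alg2) _ _ (emb_hom k0)).
apply: eval_ext => g; rewrite /gmap; case: ifP => gD.
  apply: Bk_ext; rewrite ?lo_up ?hi_up //.
  by apply/setP=> u; rewrite !inE p0 inE.
by apply: Bk_ext => //; apply/setP=> u; rewrite !inE p0 inE.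
Qed.

(** The middle element e is counted in the lower copy; this is the reason for
the second clause, which makes [D] depend on the valuation only. *)
Lemma gmapP (k : nat) (v : G -> Bk k) :
  exists p : 'I_k -> {set G}, exists D,
    v =1 gmap p D /\ (forall g, g \in D -> exists u, g \notin p u).
Proof.
exists (fun u => [set g | u \in lo (v g) :\: hi (v g)]).
exists [set g | hi (v g) != set0]; split=> [g|g].
  rewrite /gmap inE; have [h0|h0] /= := eqVneq (hi (v g)) set0.
    by apply: Bk_ext => //; apply/setP=> u; rewrite !inE h0 inE.
  have lT : lo (v g) = setT.
    by case: (Bk_lohi (v g)) => // h; rewrite h eqxx in h0.
  apply: Bk_ext; rewrite ?lo_up ?hi_up //.
  by apply/setP=> u; rewrite !inE lT inE andbT negbK.
by rewrite inE => /set0Pn[u uh]; exists u; rewrite !inE uh.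
Qed.

End Valuations.

(** * Terms that recognise a valuation *)

Section Terms.
Variable G : finType.
Implicit Types (g : G) (S D : {set G}) (X : {set {set G}}) (s t : term G).

(** On a nontrivial B_k the terms below named after a property take the value 1
when it holds and 0 otherwise. *)
Definition isone t : term G := Star (Neg (Star (Neg t))).
Definition iszero t : term G := isone (Star t).
Definition nonzero t : term G := Star (iszero t).
Definition shadow g : term G := Meet (Var g) (Neg (Var g)).
Definition literal S g : term G :=
  if g \in S then shadow g else Star (shadow g).
(** The value of [minterm S] has as lower coordinate the set of the atoms to
which exactly the generators of [S] are attached. *)
Definition minterm S : term G := \big[@Meet G/One]_g literal S g.
Definition isupper g : term G := nonzero (Star (Neg (Var g))).
Definition delta (j : {set {set G}} * {set G}) : term G :=
  Meet (\big[@Meet G/One]_S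
          if S \in j.1 then nonzero (minterm S) else iszero (minterm S))
       (\big[@Meet G/One]_g if g \in j.2 then isupper g else Star (isupper g)).
(** The pair [j] of the valuation at hand selects the only nonzero joinand, so
that [tau] can prescribe the term to be used for each pair independently. *)
Definition glue (tau : {set {set G}} * {set G} -> term G) : term G :=
  \big[@Join G/Zero]_j Meet (delta j) (tau j).

Section Eval.
Variables (k : nat) (p : 'I_k -> {set G}) (D : {set G}).
Hypothesis k0 : 0 < k.
Hypothesis pD : forall g, g \in D -> exists u, g \notin p u.
Notation ev := (eval (gmap p D)).

(** The upper coordinate of x'* is everything if x = 1 and empty otherwise,
while its lower coordinate is the upper coordinate of x: two applications of
x'* end in {0, 1}. *)
Lemma ev_isone t : ev (isone t) = emb k (hi (ev t) == setT).
Proof.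
have T0 := negPf (ord_setT0 k0).
have lo_neg (y : Bk k) : lo (aneg y) = ~: hi y by [].
have box (y : Bk k) : hi (astar (aneg y)) = if hi y == setT then setT else set0.
  by rewrite hi_star lo_neg -(inj_eq (@setC_inj _)) setCK setC0.
have lo_box (y : Bk k) : lo (astar (aneg y)) = hi y.
  by rewrite lo_star lo_neg setCK.
rewrite [LHS]/=; apply: Bk_ext; rewrite ?lo_box !box.
  by case: eqP.
by case: (hi _ == setT); rewrite ?eqxx ?T0.
Qed.

Lemma ev_iszero t : ev (iszero t) = emb k (lo (ev t) == set0).
Proof.
rewrite ev_isone [ev (Star t)]/= hi_star; congr emb.
by case: (lo (ev t) == set0); rewrite ?eqxx // (negPf (ord_setT0 k0)).
Qed.

Lemma ev_embC t b : ev t = emb k b -> ev (Star t) = emb k (~~ b).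
Proof. by move=> /= ->; rewrite (hom_star (emb_hom k0)). Qed.

Lemma ev_nonzero t : ev (nonzero t) = emb k (lo (ev t) != set0).
Proof. exact/ev_embC/ev_iszero. Qed.

(** The lower coordinate of x'* is the upper coordinate of x, which for the
value of [g] in [D] is nonempty because some [p u] misses [g]. *)
Lemma ev_isupper g : ev (isupper g) = emb k (g \in D).
Proof.
rewrite ev_nonzero; congr emb.
rewrite [ev _]/= lo_star -[lo (aneg _)]/(~: hi _) setCK /gmap.
case: ifP => [gD|_]; last by rewrite eqxx.
by have [u gu] := pD gD; rewrite hi_up; apply/set0Pn; exists u; rewrite inE.
Qed.

Lemma lo_shadow g : lo (ev (shadow g)) = [set u | g \in p u].
Proof.
have -> : lo (ev (shadow g)) = lo (gmap p D g) :&: ~: hi (gmap p D g) by [].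
apply/setP=> u; rewrite !inE /gmap; case: ifP => _.
  by rewrite lo_up hi_up !inE negbK.
by rewrite !inE andbT.
Qed.

Lemma hi_shadow g : hi (ev (shadow g)) = set0.
Proof.
have -> : hi (ev (shadow g)) = hi (gmap p D g) :&: ~: lo (gmap p D g) by [].
by rewrite /gmap; case: ifP => _; rewrite ?lo_up ?setCT ?setI0 // set0I.
Qed.

Lemma lo_literal S g :
  lo (ev (literal S g)) = [set u | (g \in p u) == (g \in S)].
Proof.
rewrite /literal; case: ifP => gS.
  by rewrite lo_shadow; apply/setP=> u; rewrite !inE eqb_id.
rewrite -[ev _]/(astar (ev (shadow g))) lo_star lo_shadow.
by apply/setP=> u; rewrite !inE eqbF_neg.
Qed.

Lemma lo_minterm S : lo (ev (minterm S)) = [set u | p u == S].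
Proof.
rewrite /minterm.
rewrite (big_morph (fun t => lo (ev t)) (id1 := setT) (op1 := @setI _)) //.
apply/setP=> u; rewrite inE; apply/bigcapP/eqP => [h|<- g _].
  by apply/setP=> g; have := h g isT; rewrite lo_literal inE => /eqP.
by rewrite lo_literal inE.
Qed.

Lemma ev_bigMeet (I : finType) (F : I -> term G) (b : pred I) :
  (forall i, ev (F i) = emb k (b i)) ->
  ev (\big[@Meet G/One]_i F i) = emb k [forall i, b i].
Proof.
move=> Fb.
have -> : [forall i, b i] = \big[andb/true]_i b i by rewrite big_andE.
rewrite (big_morph (emb k) (hom_meet (emb_hom k0)) (hom_one (emb_hom k0))).
rewrite (big_morph ev (id1 := aone (Bk k)) (op1 := @ameet (Bk k))) //.
exact: eq_bigr.
Qed.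

Lemma ev_delta j : ev (delta j) = emb k (j == ([set p u | u : 'I_k], D)).
Proof.
case: j => X E.
have lit (b : pred {set G}) : (forall S, b S = (S \in [set p u | u : 'I_k])) ->
    forall S, (lo (ev (minterm S)) != set0) = b S.
  move=> bE S; rewrite bE lo_minterm; apply/set0Pn/imsetP => [[u]|[u _ ->]].
    by rewrite inE => /eqP <-; exists u.
  by exists u; rewrite inE.
have -> : ((X, E) == ([set p u | u : 'I_k], D)) =
    [forall S, (S \in X) == (S \in [set p u | u : 'I_k])] &&
    [forall g, (g \in E) == (g \in D)].
  rewrite xpair_eqE; congr andb.
    by apply/eqP/forallP => [-> //|h]; apply/setP=> S; apply/eqP.
  by apply/eqP/forallP => [-> //|h]; apply/setP=> S; apply/eqP.
rewrite (hom_meet (emb_hom k0)) /=; congr Bk_meet; apply: ev_bigMeet => i /=.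
  rewrite -(lit _ (fun=> erefl)).
  by case: ifP => _; rewrite ?ev_nonzero ?ev_iszero //; case: (lo _ == _).
case: ifP => _; rewrite ?(ev_embC (ev_isupper _)) ?ev_isupper;
  by case: (_ \in D).
Qed.

Lemma ev_glue tau : ev (glue tau) = ev (tau ([set p u | u : 'I_k], D)).
Proof.
set j0 := (_, _); rewrite /glue.
have -> r : ev (\big[@Join G/Zero]_(j <- r) Meet (delta j) (tau j)) =
    if j0 \in r then ev (tau j0) else azero (Bk k).
  elim: r => [|j r IH]; first by rewrite big_nil.
  rewrite big_cons -[LHS]/(ajoin (ameet (ev (delta j)) (ev (tau j))) (ev _)).
  rewrite {}IH ev_delta inE -/j0 eq_sym.
  have [->|_] /= := eqVneq; case: ifP => _; apply: Bk_ext;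
    by apply/setP=> u; rewrite !inE ?orbF ?orbb ?andbb.
by rewrite mem_index_enum.
Qed.

(** The element e is the join of a nonzero shadow and its pseudocomplement.
Below e the minterms give the atoms, hence all the lower copy, and the negation
gives the upper copy. *)
Lemma ev_gen : injective p -> (exists u, p u != set0) ->
  forall x : Bk k, exists t, ev t = x.
Proof.
move=> p_inj [u0 /set0Pn[g0 gu0]].
pose e := Join (shadow g0) (Star (shadow g0)).
have A0 : lo (ev (shadow g0)) != set0.
  by rewrite lo_shadow; apply/set0Pn; exists u0; rewrite inE.
have loe : lo (ev e) = setT.
  have -> : lo (ev e) = lo (ev (shadow g0)) :|: lo (astar (ev (shadow g0))).
    by [].
  by rewrite lo_star setUCr.
have hie : hi (ev e) = set0.
  have -> : hi (ev e) = hi (ev (shadow g0)) :|: hi (astar (ev (shadow g0))).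
    by [].
  by rewrite hi_star (negPf A0) setU0 hi_shadow.
have gen_low a : exists t, ev t = low a.
  pose s := \big[@Join G/Zero]_(u in a) minterm (p u).
  have los : lo (ev s) = a.
    rewrite /s.
    rewrite (big_morph (fun t => lo (ev t)) (id1 := set0) (op1 := @setU _)) //.
    apply/setP=> u; apply/bigcupP/idP => [[w wa]|ua]; last first.
      by exists u => //; rewrite lo_minterm inE.
    by rewrite lo_minterm inE => /eqP/p_inj->.
  exists (Meet e s); apply: Bk_ext.
    have -> : lo (ev (Meet e s)) = lo (ev e) :&: lo (ev s) by [].
    by rewrite loe los setTI.
  have -> : hi (ev (Meet e s)) = hi (ev e) :&: hi (ev s) by [].
  by rewrite hie set0I.
move=> x; have [lT|h0] := Bk_lohi x.
  have [t et] := gen_low (~: hi x); exists (Neg t); rewrite /= et.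
  by apply: Bk_ext; rewrite ?lT ?[LHS]lo_up ?[LHS]hi_up.
by have [t et] := gen_low (lo x); exists t; rewrite et; apply: Bk_ext.
Qed.

End Eval.
End Terms.

(** * Counting the factors *)

Section Counting.
Variable G : finType.
Implicit Types (A D S : {set G}) (X : {set {set G}}).

Definition families (T : finType) (k : nat) (A : {set T}) :
    {set {set {set T}}} :=
  [set X : {set {set T}} | (#|X| == k) && (\bigcap_(S in X) S == A)].

(** These pairs encode the valuations that generate B_k, up to automorphism; for
k = 1 they include the valuations into {0, 1}. *)
Definition cells (k : nat) : {set {set {set G}} * {set G}} :=
  [set j : {set {set G}} * {set G} |
    (#|j.1| == k) && (j.2 \subset ~: \bigcap_(S in j.1) S)].

Lemma card_cells (k : nat) :
  #|cells k| = \sum_(A : {set G}) 2 ^ (#|G| - #|A|) * #|families k A|.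
Proof.
rewrite /cells -sum1dep_card.
rewrite -(pair_big_dep (fun X => #|X| == k)
  (fun X D => D \subset ~: \bigcap_(S in X) S) (fun _ _ => 1)) /=.
rewrite (partition_big (fun X : {set {set G}} => \bigcap_(S in X) S) xpredT) //=.
apply: eq_bigr => A _; rewrite mulnC -sum_nat_cond_const.
apply: eq_bigr => X /andP[_ /eqP->].
have -> : #|G| - #|A| = #|~: A| by rewrite [RHS]cardsCs setCK.
by rewrite sum1dep_card -card_powerset; apply: eq_card => D; rewrite !inE.
Qed.

Lemma sum_card (f : nat -> nat) :
  \sum_(A : {set G}) f #|A| = \sum_(0 <= i < #|G|.+1) 'C(#|G|, i) * f i.
Proof.
rewrite big_mkord.
rewrite (partition_big (fun A : {set G} => inord #|A| : 'I_#|G|.+1) xpredT) //=.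
apply: eq_bigr => i _; rewrite -card_draws -sum_nat_cond_const.
have e A : (inord #|A| == i) = (#|A| == i).
  by rewrite -val_eqE /= inordK // ltnS max_card.
by rewrite (eq_bigl _ _ e); apply: eq_bigr => A /eqP->.
Qed.

Lemma bigcap_imset (T I : finType) (f : I -> {set T}) (Y : {set I}) :
  \bigcap_(S in f @: Y) S = \bigcap_(i in Y) f i.
Proof.
apply/setP=> x; apply/bigcapP/bigcapP => h.
  by move=> i iY; apply/h/imset_f.
by move=> _ /imsetP[i iY ->]; apply: h.
Qed.

(** Adding [A] to each member is a bijection from the families on the
complement of [A] with empty intersection to the families with intersection
[A]. *)
Lemma card_families (k : nat) A : 0 < k ->
  #|families k A| = #|families k (set0 : {set 'I_(#|G| - #|A|)})|.
Proof.
move=> k0; have -> : #|G| - #|A| = #|~: A| by rewrite [RHS]cardsCs setCK.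
pose e (i : 'I_#|~: A|) : G := enum_val i.
have eA i : e i \notin A by have := enum_valP i; rewrite inE.
have e_inj : injective e by exact: enum_val_inj.
pose over (T : {set 'I_#|~: A|}) := A :|: e @: T.
have over_inj : injective over.
  move=> T U /setP TU; apply/setP=> i; have := TU (e i).
  by rewrite !in_setU !(mem_imset _ _ e_inj) !(negPf (eA i)).
have cap_over (Y : {set {set 'I_#|~: A|}}) : Y != set0 ->
    \bigcap_(S in over @: Y) S = over (\bigcap_(T in Y) T).
  case/set0Pn=> T0 YT0; rewrite bigcap_imset; apply/setP=> x; rewrite !inE.
  apply/bigcapP/idP => [h|].
    have [//|xA] /= := boolP (x \in A).
    have := h T0 YT0; rewrite inE (negPf xA) => /imsetP[i _ def_x].
    rewrite def_x mem_imset //; apply/bigcapP=> T TY.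
    by have := h T TY; rewrite inE (negPf xA) def_x mem_imset.
  case/orP=> [xA|/imsetP[i /bigcapP hi ->]] T TY; rewrite inE ?xA //.
  by rewrite mem_imset ?hi ?orbT.
have over0 : over set0 = A by rewrite /over imset0 setU0.
have k_neq0 (T : finType) (Y : {set T}) : #|Y| == k -> Y != set0.
  by move/eqP=> Yk; rewrite -card_gt0 Yk.
have imI := imset_inj over_inj.
rewrite -(card_imset (families k (set0 : {set 'I_#|~: A|})) imI).
apply: eq_card => X; apply/idP/imsetP => [|[Y]]; rewrite !inE; last first.
  case/andP=> Yk /eqP Y0 ->.
  by rewrite card_imset // Yk cap_over ?Y0 ?over0 ?eqxx //; apply: k_neq0 Yk.
case/andP=> Xk /eqP XA.
have defX : X = over @: (over @^-1: X).
  apply/setP=> S; apply/idP/imsetP => [SX|[T]]; last by rewrite inE => ? ->.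
  exists (e @^-1: S).
    rewrite inE; suff -> : over (e @^-1: S) = S by [].
    apply/setP=> x; rewrite !inE; have [xA|xA] /= := boolP (x \in A).
      by move: xA; rewrite -XA => /bigcapP/(_ S SX).
    apply/imsetP/idP => [[i]|xS]; first by rewrite inE => iS ->.
    have xA' : x \in ~: A by rewrite inE.
    by exists (enum_rank_in xA' x); rewrite ?inE /e enum_rankK_in.
  apply/setP=> x; rewrite !inE; have [xA|xA] /= := boolP (x \in A).
    by move: xA; rewrite -XA => /bigcapP/(_ S SX).
  apply/idP/imsetP => [xS|[i]]; last by rewrite inE => iS ->.
  have xA' : x \in ~: A by rewrite inE.
  by exists (enum_rank_in xA' x); rewrite ?inE /e enum_rankK_in.
exists (over @^-1: X) => //; rewrite inE.
have Yk : #|over @^-1: X| == k by rewrite -(card_imset _ over_inj) -defX.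
rewrite Yk /=; apply/eqP/over_inj; rewrite -cap_over ?over0 -?defX //.
exact: k_neq0 Yk.
Qed.

End Counting.

(** By cardinality, an injection with values in [Y] has image [Y]. *)
Lemma card_ffun_imset (k : nat) (T : finType) (Y : {set T}) : #|Y| = k ->
  #|[set p : {ffun 'I_k -> T} | injectiveb p && (p @: setT == Y)]| = k`!.
Proof.
move=> Yk; have -> : k`! = #|Y| ^_ #|'I_k| by rewrite card_ord Yk ffactnn.
rewrite -card_inj_ffuns_on.
apply: eq_card => p; rewrite !inE andbC.
have [/injectiveP p_inj|] := boolP (injectiveb p); rewrite ?andbF // !andbT.
rewrite eqEcard card_imset // cardsT card_ord Yk leqnn andbT.
apply/subsetP/ffun_onP => [h i|h _ /imsetP[i _ ->]]; last exact: h.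
by apply/h/imset_f.
Qed.

(** Both sides are homomorphisms with the same values on the generators. *)
Lemma bool_hom_dual (m k : nat) (h : FreeBool m -> {set 'I_k}) X :
  is_bool_hom h -> h X = [set u | [set i | u \in h (bgen i)] \in X].
Proof.
move=> hh; have [h0 [_ _ uniq_h]] := FreeBool_free (fun i => h (bgen i)).
rewrite (uniq_h h) //.
rewrite -(uniq_h (fun X => [set u | [set i | u \in h (bgen i)] \in X])) //.
  by split=> *; apply/setP=> u; rewrite !inE.
by move=> i; apply/setP=> u; rewrite !inE.
Qed.

(** A homomorphism onto the Boolean algebra with [k] atoms is dual to an
injection of the atoms into the valuations of the generators; no generator is
sent to the top iff the points of the injection have empty intersection. Each
family of [k] points is enumerated by [k`!] injections. *)
Lemma gnum_families (m k : nat) : 0 < k ->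
  gnum m k = k`! * #|families k (set0 : {set 'I_m})|.
Proof.
move=> k0.
pose dual (p : {ffun 'I_k -> {set 'I_m}}) : {ffun FreeBool m -> {set 'I_k}} :=
  [ffun X : FreeBool m => [set u | p u \in X]].
have dual_hom p : is_bool_hom (dual p).
  by split=> *; apply/setP=> u; rewrite !ffunE !inE ?ffunE ?inE.
have dual_gen p i : dual p (bgen i) = [set u | i \in p u].
  by apply/setP=> u; rewrite ffunE !inE.
have dual_inj : injective dual.
  move=> p q /ffunP pq; apply/ffunP=> u; apply/setP=> i.
  by have /setP/(_ u) := pq (bgen i); rewrite !dual_gen !inE.
pose pts := [set p : {ffun 'I_k -> {set 'I_m}} |
  injectiveb p && (\bigcap_(S in p @: setT) S == set0)].
have -> : gnum m k = #|pts|.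
  rewrite -(card_imset pts dual_inj); apply: eq_card => h.
  apply/idP/imsetP => [|[p]]; rewrite !inE.
    case/and3P=> /is_bool_homP hh /forallP h_surj /forallP h_neq1.
    pose p : {ffun 'I_k -> {set 'I_m}} :=
      [ffun u => [set i | u \in h (bgen i)]].
    have def_h : h = dual p.
      apply/ffunP=> X; rewrite (bool_hom_dual X hh).
      by apply/setP=> u; rewrite !ffunE !inE ffunE.
    exists p => //; rewrite inE; apply/andP; split.
      apply/injectiveP=> u w pu; have /existsP[X /eqP hX] := h_surj [set u].
      apply/esym/set1P; rewrite -hX def_h ffunE inE -pu.
      by have := set11 u; rewrite -hX def_h ffunE inE.
    rewrite bigcap_imset -subset0; apply/subsetP=> i /bigcapP hi.
    case/eqP: (h_neq1 i); rewrite def_h dual_gen; apply/setP=> u.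
    by rewrite !inE hi.
  case/andP=> /injectiveP p_inj /eqP/setP p0 ->; apply/and3P; split.
  - exact/is_bool_homP.
  - apply/forallP=> Y; apply/existsP; exists (p @: Y); apply/eqP.
    by apply/setP=> u; rewrite ffunE inE mem_imset.
  - apply/forallP=> i; apply/eqP; rewrite dual_gen => /setP hi.
    have := p0 i; rewrite inE bigcap_imset => /bigcapP[] u _.
    by have := hi u; rewrite !inE.
rewrite -sum1_card (partition_big (fun p : {ffun _} => p @: setT)
  (mem (families k (set0 : {set 'I_m})))) /=.
  rewrite mulnC -sum_nat_const; apply: eq_bigr => Y.
  rewrite inE => /andP[/eqP Yk Y0].
  rewrite -(card_ffun_imset Yk) sum1dep_card; apply: eq_card => p.
  rewrite !inE -andbA; congr andb; apply: andb_idl => /eqP->.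
  exact: Y0.
move=> p; rewrite !inE => /andP[/injectiveP p_inj ->].
by rewrite card_imset // cardsT card_ord eqxx.
Qed.

Lemma sum_fnum (G : finType) (k : nat) : 0 < k ->
  \sum_(0 <= i < #|G|.+1) 2 ^ (#|G| - i) * fnum #|G| k i = k`! * #|cells G k|.
Proof.
move=> k0; rewrite card_cells big_distrr /=.
pose f i := k`! * (2 ^ (#|G| - i) * #|families k (set0 : {set 'I_(#|G| - i)})|).
rewrite (eq_bigr (fun A : {set G} => f #|A|)) => [|A _]; last first.
  by rewrite /f -card_families.
rewrite sum_card; apply: eq_bigr => i _.
by rewrite /f /fnum gnum_families // mulnCA; congr (_ * _); rewrite mulnCA.
Qed.

(** Here [X] is a singleton {S}, and the pairs (S, D) of disjoint sets
correspond to the maps from [G] to a set with three elements. *)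
Lemma card_cells1 (G : finType) : #|cells G 1| = 3 ^ #|G|.
Proof.
rewrite card_cells (eq_bigr (fun A : {set G} => 2 ^ (#|G| - #|A|))) => [|A _].
  rewrite (sum_card G (fun i => 2 ^ (#|G| - i))) -[3]/(2 + 1) expnDn big_mkord.
  by apply: eq_bigr => i _; rewrite exp1n muln1.
suff -> : families 1 A = [set [set A]] by rewrite cards1 muln1.
apply/setP=> X; rewrite !inE; apply/andP/eqP => [[/cards1P[S ->]]|->].
  by rewrite big_set1 => /eqP->.
by rewrite cards1 big_set1.
Qed.

(** The pairs for which the valuation in B_1 takes the value e, that is,
generates 3 rather than 2. *)
Definition cells3 (G : finType) : {set {set {set G}} * {set G}} :=
  [set j in cells G 1 | j.1 != [set set0]].

Lemma card_cells3 (G : finType) : #|cells3 G| = 3 ^ #|G| - 2 ^ #|G|.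
Proof.
rewrite -card_cells1 -(cardsID [set j | j.1 == [set set0]] (cells G 1)).
have -> : #|cells G 1 :&: [set j | j.1 == [set set0]]| = 2 ^ #|G|.
  have pair_inj :
      injective (fun D : {set G} => ([set set0] : {set {set G}}, D)).
    by move=> ? ? [].
  rewrite -cardsT -card_powerset -(card_imset (powerset _) pair_inj).
  apply: eq_card => -[X D].
  apply/idP/imsetP => [|[E _ [-> ->]]]; rewrite !inE /=.
    by case/andP=> _ /eqP->; exists D; rewrite ?inE ?subsetT.
  by rewrite cards1 big_set1 setC0 subsetT !eqxx.
by rewrite addnC addnK; apply: eq_card => j; rewrite !inE andbC.
Qed.

(** * The product as a free algebra *)

Lemma variety_prod2 (V : alg -> Prop) (A B : alg) :
  is_variety V -> V A -> V B -> V (alg_prod2 A B).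
Proof.
move=> hV VA VB; pose C (b : bool) := if b then A else B.
have VC : V (alg_prod C) by apply: (variety_P hV) => -[].
pose h (x : alg_prod2 A B) : alg_prod C :=
  fun b => if b as b0 return C b0 then x.1 else x.2.
apply: (variety_S (h := h) hV VC).
  by split=> *; apply: functional_extensionality_dep => -[].
move=> [x1 x2] [y1 y2] xy.
have /= -> := congr1 (fun f : alg_prod C => f true) xy.
by have /= -> := congr1 (fun f : alg_prod C => f false) xy.
Qed.

Section Enumeration.
Variables (T : finType) (x0 : T) (J : {set T}) (N : nat).
Hypothesis cardJ : #|J| = N.

Lemma nth_enum_in (i : 'I_N) : nth x0 (enum J) i \in J.
Proof. by rewrite -mem_enum mem_nth // -cardE cardJ ltn_ord. Qed.

Lemma nth_enum_inj : injective (fun i : 'I_N => nth x0 (enum J) i).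
Proof.
move=> i j /eqP; rewrite nth_uniq ?enum_uniq -?cardE ?cardJ ?ltn_ord //.
by move/eqP/val_inj.
Qed.

Lemma nth_enum_surj x : x \in J -> exists i : 'I_N, nth x0 (enum J) i = x.
Proof.
rewrite -mem_enum => xJ.
have iN : index x (enum J) < N by rewrite -cardJ cardE index_mem.
by exists (Ordinal iN); apply: nth_index.
Qed.

End Enumeration.

(** In this section [m] and [N] stand for the exponents of 3 and of the B_k;
their values enter only through the number of factors of each kind. *)
Section Target.
Variables (G : finType) (m : nat) (N : nat -> nat).
Hypothesis mE : #|cells3 G| = m.
Hypothesis NE : forall k, 2 <= k <= 2 ^ #|G| -> #|cells G k| = N k.
Implicit Types (g : G) (D : {set G}) (X : {set {set G}}) (s t : term G).

Definition pts (k : nat) X (u : 'I_k) : {set G} := nth set0 (enum X) u.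

Definition target : alg :=
  alg_prod2 (alg_pow alg2 (2 ^ #|G|))
    (alg_prod2 (alg_pow alg3 m)
      (alg_prod (fun k : {k : nat | 2 <= k <= 2 ^ #|G|} =>
        alg_pow (Bk (val k)) (N (val k))))).

Definition cell2 (i : nat) : {set G} := nth set0 (enum (powerset [set: G])) i.
Definition cell3 (i : nat) := nth (set0, set0) (enum (cells3 G)) i.
Definition cellk (k i : nat) := nth (set0, set0) (enum (cells G k)) i.

Definition gen2 D g : alg2 := g \in D.
Definition genk (k : nat) (j : {set {set G}} * {set G}) : G -> Bk k :=
  gmap (@pts k j.1) j.2.

(** The free generators of the product: each factor carries the valuation of its
own pair. *)
Definition tgen g : target :=
  (fun i : 'I__ => gen2 (cell2 i) g,
   (fun i : 'I__ => genk 1 (cell3 i) g,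
    fun k (i : 'I__) => genk (val k) (cellk (val k) i) g)).

Lemma eval_tgen2 t i : (eval tgen t).1 i = eval (gen2 (cell2 i)) t.
Proof. exact: (eval_hom (h := fun x : target => x.1 i : alg2)). Qed.

Lemma eval_tgen3 t i : (eval tgen t).2.1 i = eval (genk 1 (cell3 i)) t.
Proof. exact: (eval_hom (h := fun x : target => x.2.1 i : alg3)). Qed.

Lemma eval_tgenk t k i :
  (eval tgen t).2.2 k i = eval (genk (val k) (cellk (val k) i)) t.
Proof. exact: (eval_hom (h := fun x : target => x.2.2 k i : Bk (val k))). Qed.

Lemma pts_inj (k : nat) X : #|X| = k -> injective (@pts k X).
Proof.
exact: nth_enum_inj.
Qed.

Lemma im_pts (k : nat) X : #|X| = k -> [set pts X u | u : 'I_k] = X.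
Proof.
move=> Xk; apply/eqP; rewrite eqEcard card_imset; last exact: pts_inj.
rewrite card_ord Xk leqnn andbT; apply/subsetP=> _ /imsetP[u _ ->].
exact: nth_enum_in.
Qed.

Lemma card_cell2 : #|powerset [set: G]| = 2 ^ #|G|.
Proof. by rewrite card_powerset cardsT. Qed.

Lemma cell2_inj : injective (fun i : 'I_(2 ^ #|G|) => cell2 i).
Proof. exact: nth_enum_inj card_cell2. Qed.

Lemma cell2_surj D : exists i : 'I_(2 ^ #|G|), cell2 i = D.
Proof. by apply: (nth_enum_surj set0 card_cell2); rewrite inE subsetT. Qed.

Lemma cell3_in (i : 'I_m) : cell3 i \in cells3 G.
Proof. exact: nth_enum_in. Qed.

Lemma cell3_inj : injective (fun i : 'I_m => cell3 i).
Proof. exact: nth_enum_inj. Qed.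

Lemma cell3_surj j : j \in cells3 G -> exists i : 'I_m, cell3 i = j.
Proof. exact: nth_enum_surj. Qed.

Section CellK.
Variable k : {k | 2 <= k <= 2 ^ #|G|}.

Lemma cellk_in (i : 'I_(N (val k))) : cellk (val k) i \in cells G (val k).
Proof. exact: nth_enum_in (NE (valP k)) i. Qed.

Lemma cellk_inj : injective (fun i : 'I_(N (val k)) => cellk (val k) i).
Proof. exact: nth_enum_inj (NE (valP k)). Qed.

Lemma cellk_surj j :
  j \in cells G (val k) -> exists i : 'I_(N (val k)), cellk (val k) i = j.
Proof. exact: nth_enum_surj (NE (valP k)) j. Qed.

End CellK.

(** The valuation [v] has a pair (X, D). If X is {empty set}, then [v] takes
values in {0, 1} and comes from a factor 2; otherwise it is the pullback of the
valuation of the factor indexed by (X, D), along the map that sends an atom [u]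
to the position of [p u] in the enumeration of X. *)
Lemma target_sep (k : nat) (v : G -> Bk k) s t :
  0 < k -> eval tgen s = eval tgen t -> eval v s = eval v t.
Proof.
move=> k0 st; have [p [D [vE pD]]] := gmapP v.
rewrite !(eval_ext _ vE) {vE v}.
pose X := [set p u | u : 'I_k].
have pX u : p u \in X by apply: imset_f.
have [X0|X0] := eqVneq X [set set0].
  have p0 u : p u = set0 by apply/set1P; rewrite -X0.
  rewrite !eval_gmap_set0 //; congr emb; have [i <-] := cell2_surj D.
  by have := congr1 (fun x : target => x.1 i) st; rewrite !eval_tgen2.
have Xgt0 : 0 < #|X| by apply/card_gt0P; exists (p (Ordinal k0)).
have jC : (X, D) \in cells G #|X|.
  rewrite inE eqxx /=; apply/subsetP=> g /pD[u gu].
  by rewrite inE; apply: contra gu => /bigcapP; apply.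
suff st' : eval (genk #|X| (X, D)) s = eval (genk #|X| (X, D)) t.
  have idx_lt u : index (p u) (enum X) < #|X|.
    by rewrite cardE index_mem mem_enum.
  pose psi u : 'I_#|X| := Ordinal (idx_lt u).
  have pE u : pts X (psi u) = p u by rewrite /pts /= nth_index // mem_enum.
  have vE : gmap p D =1 gmap (fun u => pts X (psi u)) D.
    by move=> g; rewrite /gmap; case: ifP => _; congr (_ _); apply/setP=> u;
      rewrite !inE pE.
  have psi_surj j : exists u, psi u = j.
    have /imsetP[u _ ju] : pts X j \in X by apply: (nth_enum_in set0 erefl).
    by exists u; apply: (@pts_inj _ X); rewrite ?pE.
  by rewrite !(eval_ext _ vE) !eval_gmap_comp //; congr pull.
have [X1|X1] := eqVneq #|X| 1.
  have /cell3_surj[i ji] : (X, D) \in cells3 G by rewrite inE -X1 jC.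
  have := congr1 (fun x : target => x.2.1 i) st.
  by rewrite !eval_tgen3 ji X1.
have Xle : 2 <= #|X| <= 2 ^ #|G|.
  rewrite ltn_neqAle eq_sym X1 Xgt0 /= -card_cell2 powersetT.
  exact: subset_leq_card (subsetT X).
pose kX : {k | 2 <= k <= 2 ^ #|G|} := exist _ #|X| Xle.
have [i ji] := @cellk_surj kX _ jC.
have := congr1 (fun x : target => x.2.2 kX i) st.
by rewrite !eval_tgenk ji.
Qed.

(** The exclusion of {empty set} provides the nonzero shadow that produces e. *)
Lemma genk_gen (k : nat) (j : {set {set G}} * {set G}) (x : Bk k) :
  0 < k -> j \in cells G k -> j.1 != [set set0] ->
  exists t, eval (genk k j) t = x.
Proof.
case: j => X D /=; rewrite inE /= => k0 /andP[/eqP Xk _] X0.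
apply: ev_gen => //; first exact: pts_inj.
suff /exists_inP[S SX S0] : [exists S in X, S != set0].
  have /imsetP[u _ Su] : S \in [set pts X u | u : 'I_k] by rewrite im_pts.
  by exists u; rewrite -Su.
apply: contraNT X0 => /exists_inPn X0.
rewrite eqEcard cards1 Xk k0 andbT; apply/subsetP=> S /X0.
by rewrite negbK inE.
Qed.

Lemma ev_glue_genk (k : nat) tau (j : {set {set G}} * {set G}) :
  0 < k -> j \in cells G k ->
  eval (genk k j) (glue tau) = eval (genk k j) (tau j).
Proof.
case: j => X D k0; rewrite inE /= => /andP[/eqP Xk XD].
rewrite /genk ev_glue //= ?im_pts // => g /(subsetP XD).
rewrite inE => /bigcapP gX.
suff /existsP[u gu] : [exists u : 'I_k, g \notin pts X u] by exists u.
apply: contraT => /existsPn gu; case: gX => S.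
by rewrite -(im_pts Xk) => /imsetP[u _ ->]; have := gu u; rewrite negbK.
Qed.

(** Inside B_1 the factor 2 with index [D] has the pair ({empty set}, D). *)
Lemma ev_glue_gen2 tau D :
  eval (gen2 D) (glue tau) = eval (gen2 D) (tau ([set set0], D)).
Proof.
apply: (@emb_inj 1) => //; rewrite -!(eval_gmap_set0 (p := fun=> set0)) //.
rewrite ev_glue // => [|g _]; last by exists ord0; rewrite inE.
congr (eval _ (tau (_, _))); apply/setP=> S; rewrite inE.
by apply/imsetP/eqP => [[]|->] //; exists ord0.
Qed.

(** Distinct factors have distinct pairs, so a term for each coordinate of [x]
can be chosen as a function [tau] of the pair, and the chosen terms can be
glued. *)
Lemma target_gen (x : target) : exists t, eval tgen t = x.
Proof.
suff /fin_all_exists[tau tauP] : forall j : {set {set G}} * {set G}, exists t,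
    [/\ forall i : 'I__,
          j = ([set set0], cell2 i) -> eval (gen2 (cell2 i)) t = x.1 i,
        forall i : 'I__, j = cell3 i -> eval (genk 1 j) t = x.2.1 i
      & forall k (i : 'I__),
          j = cellk (val k) i -> eval (genk (val k) j) t = x.2.2 k i].
  exists (glue tau); case: x tauP => x1 [x2 x3] /= tauP.
  have e1 : (eval tgen (glue tau)).1 = x1.
    apply: functional_extensionality_dep => i; rewrite eval_tgen2 ev_glue_gen2.
    by case: (tauP ([set set0], cell2 i)) => h _ _; apply: h.
  have e2 : (eval tgen (glue tau)).2.1 = x2.
    apply: functional_extensionality_dep => i; rewrite eval_tgen3.
    have := cell3_in i; rewrite inE => /andP[/ev_glue_genk-> // _].
    by case: (tauP (cell3 i)) => _ h _; apply: h.
  have e3 : (eval tgen (glue tau)).2.2 = x3.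
    apply: functional_extensionality_dep => k.
    apply: functional_extensionality_dep => i; rewrite eval_tgenk.
    have k0 : 0 < val k by case/andP: (valP k) => /ltnW.
    rewrite (ev_glue_genk _ k0 (cellk_in i)).
    by case: (tauP (cellk (val k) i)) => _ _ h; apply: h.
  by rewrite -e1 -e2 -e3 -!surjective_pairing.
move=> j.
have k1 (k : {k | 2 <= k <= 2 ^ #|G|}) : val k != 1.
  by case/andP: (valP k) => + _; case: (val k) => [|[]].
have card_j (k : {k | 2 <= k <= 2 ^ #|G|}) (i : 'I_(N (val k))) :
    j = cellk (val k) i -> #|j.1| = val k.
  by move=> ->; have := cellk_in i; rewrite inE => /andP[/eqP].
have [j0|j0] := eqVneq j.1 [set set0].
  have [i0 ji0] := cell2_surj j.2.
  exists (if x.1 i0 then One else Zero); split=> [i ji|i ji|k i ji].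
  - have -> : i = i0 by apply: cell2_inj; rewrite ji0 ji.
    by case: (x.1 _).
  - by have := cell3_in i; rewrite -ji !inE j0 eqxx andbF.
  - by case/eqP: (k1 k); rewrite -(card_j _ _ ji) j0 cards1.
have no2 i : j <> ([set set0], cell2 i) by move=> ji; rewrite ji eqxx in j0.
have [jc|jc] := boolP (j \in cells G 1).
  have /cell3_surj[i0 ji0] : j \in cells3 G by rewrite inE jc.
  have [t tP] := genk_gen (x.2.1 i0) isT jc j0.
  exists t; split=> [i /no2//|i ji|k i ji].
    by rewrite tP (_ : i = i0) //; apply: cell3_inj; rewrite ji0 -ji.
  case/eqP: (k1 k); rewrite -(card_j _ _ ji).
  by move: jc; rewrite inE => /andP[/eqP].
have no3 (i : 'I_m) : j <> cell3 i.
  by move=> ji; have := cell3_in i; rewrite -ji inE (negPf jc).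
have [/andP[jk k_le]|jk] :=
    boolP ((j \in cells G #|j.1|) && (2 <= #|j.1| <= 2 ^ #|G|)).
  pose kj : {k | 2 <= k <= 2 ^ #|G|} := exist _ #|j.1| k_le.
  have [i0 ji0] := @cellk_surj kj _ jk.
  have kj0 : 0 < #|j.1| by case/andP: (k_le) => /ltnW.
  have [t tP] := genk_gen (x.2.2 kj i0) kj0 jk j0.
  exists t; split=> [i /no2//|i /no3//|k i ji].
  have kE : k = kj by apply: val_inj; rewrite /= (card_j _ _ ji).
  subst k; rewrite tP (_ : i = i0) //.
  by apply: (@cellk_inj kj); rewrite ji0 -ji.
(* Otherwise [j] is the pair of no factor, and any term will do. *)
exists Zero; split=> [i /no2//|i /no3//|k i ji]; case/negP: jk.
by rewrite (card_j _ _ ji) (valP k) andbT ji cellk_in.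
Qed.

Lemma target_BPK0 : BPK0 target.
Proof.
move=> V hV VB.
have VBk k : 0 < k -> V (Bk k) by move=> k0; apply: VB; exists k.
apply: variety_prod2 => //.
  apply: (variety_P hV) => _.
  by apply: (variety_S hV (VBk 1 isT) (emb_hom _) (@emb_inj 1 _)).
apply: variety_prod2 => //; first by apply: (variety_P hV) => _; apply: VBk.
apply: (variety_P hV) => k; apply: (variety_P hV) => _; apply: VBk.
by case/andP: (valP k) => /ltnW.
Qed.

(** Having all the identities of the product at [tgen] defines a variety. *)
Lemma target_identities (A : alg) (v : G -> A) s t :
  BPK0 A -> eval tgen s = eval tgen t -> eval v s = eval v t.
Proof.
pose V (B : alg) := forall (w : G -> B) s t,
  eval tgen s = eval tgen t -> eval w s = eval w t.
suff hV : is_variety V.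
  by move=> BA; apply: (BA V hV) => _ [k k0 ->] w s' t'; apply: target_sep.
split=> [B C h VB hh h_surj|B C h VB hh h_inj|I C VC] w s' t' st.
- have /fin_all_exists[w' w'E] : forall g, exists x, h x = w g by move=> g.
  have wE : w =1 (fun g => h (w' g)) by move=> g.
  by rewrite !(eval_ext _ wE) -!(eval_hom _ _ hh) (VB _ _ _ st).
- by apply: h_inj; rewrite !(eval_hom _ _ hh); apply: VB.
- apply: functional_extensionality_dep => i.
  by rewrite !(eval_hom (h := fun x : alg_prod C => x i)) //; apply: VC.
Qed.

(** The homomorphism [h] from [F] comes from freeness; the one in the other
direction evaluates in [F] a term that represents the given element of the
product.  The composite on [F] fixes the generators, hence is the identity by
uniqueness. *)
Lemma free_target (F : alg) (iota : G -> F) :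
  is_free BPK0 iota -> alg_iso F target.
Proof.
case=> BF univ.
have [h [hh h_iota _]] := univ _ tgen target_BPK0.
have [rep repK] : exists rep : target -> term G,
    forall x, eval tgen (rep x) = x.
  exact: (functional_choice _ target_gen).
pose q (x : target) : F := eval iota (rep x).
(* The value of [q] does not depend on the chosen term. *)
have qE t : q (eval tgen t) = eval iota t.
  by apply: target_identities => //; rewrite repK.
have hE t : h (eval iota t) = eval tgen t.
  by rewrite (eval_hom _ _ hh); apply: eval_ext.
have qh : is_hom q.
  have q2 (op : forall B : alg, B -> B -> B) top :
      (forall (B : alg) (v : G -> B) s t,
        eval v (top s t) = op B (eval v s) (eval v t)) ->
      forall x y, q (op _ x y) = op _ (q x) (q y).
    by move=> opE x y; rewrite -{1}(repK x) -{1}(repK y) -opE qE opE.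
  have q1 (op : forall B : alg, B -> B) top :
      (forall (B : alg) (v : G -> B) s, eval v (top s) = op B (eval v s)) ->
      forall x, q (op _ x) = op _ (q x).
    by move=> opE x; rewrite -{1}(repK x) -opE qE opE.
  split.
  - exact: (q2 ameet (@Meet G)).
  - exact: (q2 ajoin (@Join G)).
  - exact: (q1 aneg (@Neg G)).
  - exact: (q1 astar (@Star G)).
  - exact: (qE Zero).
  - exact: (qE One).
exists h; split=> //; exists q => x; last by rewrite /q hE repK.
have [f [_ _ uniq_f]] := univ F iota BF.
have -> : q (h x) = f x.
  apply: (uniq_f (fun x => q (h x))) => [|g].
    2: by rewrite h_iota (qE (Var g)).
  by case: hh qh => [a1 a2 a3 a4 a5 a6] [b1 b2 b3 b4 b5 b6];
    split=> *; rewrite ?a1 ?a2 ?a3 ?a4 ?a5 ?a6.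
by rewrite -(uniq_f id).
Qed.

End Target.

Theorem mainTheorem8 (G : finType) (n : nat) (hn : #|G| = n)
    (F : alg) (iota : G -> F) (hF : is_free BPK0 iota) :
  (forall k : nat, 2 <= k <= 2 ^ n ->
     k`! %| \sum_(0 <= i < n.+1) 2 ^ (n - i) * fnum n k i) /\
  alg_iso F
    (alg_prod2 (alg_pow alg2 (2 ^ n))
      (alg_prod2 (alg_pow alg3 (3 ^ n - 2 ^ n))
        (alg_prod (fun k : {k : nat | 2 <= k <= 2 ^ n} =>
           alg_pow (Bk (val k))
             ((\sum_(0 <= i < n.+1) 2 ^ (n - i) * fnum n (val k) i)
                %/ (val k)`!))))).
Proof.
subst n; split=> [k /andP[/ltnW k0 _]|].
  by rewrite sum_fnum // dvdn_mulr.
apply: (@free_target G (3 ^ #|G| - 2 ^ #|G|) (fun k =>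
  (\sum_(0 <= i < #|G|.+1) 2 ^ (#|G| - i) * fnum #|G| k i) %/ k`!)) hF.
  by rewrite card_cells3.
by move=> k /andP[/ltnW k0 _]; rewrite sum_fnum // mulKn // fact_gt0.
Qed.
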